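(* Let $M$ be a complete flat pseudo-Riemannian homogeneous manifold of dimension $n$ and signature $(n-s,s)$, where $n-s\geq s$, and let $\Gamma$ be its fundamental group. If the linear holonomy group $\mathrm{Hol}(\Gamma)$ is non-abelian, then $\dim M\geq 14$ and the signature $(n-s,s)$ of $M$ satisfies $n-s\geq s\geq 7$.
   Context: $\mathbb{R}^n_s$ denotes $\mathbb{R}^n$ with a non-degenerate symmetric bilinear form of signature $(n-s,s)$, and $\mathrm{Iso}(\mathbb{R}^n_s)$ is its group of (affine) isometries. Throughout, signatures are normalized so that $n-s\geq s$. Complete means geodesically complete; homogeneous means that the isometry group of $M$ acts transitively on $M$. A complete flat pseudo-Riemannian homogeneous manifold $M$ has the form $M=\mathbb{R}^n_s/\Gamma$, where the fundamental group $\Gamma\subset\mathrm{Iso}(\mathbb{R}^n_s)$ acts freely and properly discontinuously as group of deck transformations; homogeneity of $M$ is equivalent to the centralizer of $\Gamma$ in $\mathrm{Iso}(\mathbb{R}^n_s)$ acting transitively on $\mathbb{R}^n_s$. Affine maps are written $\gamma=(I+A,v)$, with linear part $I+A$ and translation part $v$. The linear holonomy group is $\mathrm{Hol}(\Gamma)=\{I+A \mid (I+A,v)\in\Gamma\}$. *)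

(* Defs.v *)
From HB Require Import structures.
From mathcomp Require Import all_boot all_order all_algebra.
From mathcomp Require Import all_classical all_reals all_analysis.
Import numFieldNormedType.Exports.

Set Implicit Arguments.
Unset Strict Implicit.
Unset Printing Implicit Defensive.

Import Order.TTheory GRing.Theory Num.Theory.
Local Open Scope classical_set_scope.
Local Open Scope ring_scope.

Definition bform (R : realType) (n : nat) (B : 'M[R]_n) (x y : 'cV[R]_n) : R :=
  (x^T *m B *m y) 0 0.

(* B has signature (p, q): the form has an orthogonal basis, the columns of P,
   with p vectors of square 1 and q of square -1. As p + q = n, the form is
   then symmetric and non-degenerate. *)
Definition has_signature (R : realType) (n : nat) (B : 'M[R]_n) (p q : nat) :
    Prop :=
  (p + q = n)%N /\
  exists2 P : 'M[R]_n, P \in unitmx &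
    P^T *m B *m P = diag_mx (\row_(i < n) (if (i < p)%N then 1 else -1)).

(* The affine map x |-> L x + v is the pair (L, v); in the notation
   (I + A, v), the linear part L is I + A. *)
Definition affine (R : realType) (n : nat) : Type := ('M[R]_n * 'cV[R]_n)%type.

Section AffineMaps.
Variables (R : realType) (n : nat).
Implicit Types (g h : affine R n) (x : 'cV[R]_n).

Definition aff_act g x : 'cV[R]_n := g.1 *m x + g.2.

Definition aff_one : affine R n := (1%:M, 0).

Definition aff_mul g h : affine R n := (g.1 *m h.1, g.1 *m h.2 + g.2).

Definition aff_inv g : affine R n := (invmx g.1, - (invmx g.1 *m g.2)).

Definition isometries (B : 'M[R]_n) : set (affine R n) :=
  [set g | forall x y, bform B (g.1 *m x) (g.1 *m y) = bform B x y].

Definition is_subgroup (Gamma : set (affine R n)) : Prop :=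
  [/\ Gamma aff_one,
      forall g h, Gamma g -> Gamma h -> Gamma (aff_mul g h)
    & forall g, Gamma g -> Gamma (aff_inv g)].

Definition acts_freely (Gamma : set (affine R n)) : Prop :=
  forall g x, Gamma g -> aff_act g x = x -> g = aff_one.

Definition acts_properly_discontinuously (Gamma : set (affine R n)) : Prop :=
  forall K : set 'cV[R]_n, compact K ->
    finite_set [set g | Gamma g /\ (aff_act g @` K) `&` K !=set0].

Definition holonomy (Gamma : set (affine R n)) : set 'M[R]_n :=
  [set L | exists v, Gamma (L, v)].

End AffineMaps.

(* Gamma is the deck transformation group, hence the fundamental group, of the
   complete flat pseudo-Riemannian manifold R^n / Gamma. *)
Definition deck_group (R : realType) (n : nat) (B : 'M[R]_n)
    (Gamma : set (affine R n)) : Prop :=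
  [/\ Gamma `<=` isometries B, is_subgroup Gamma, acts_freely Gamma
    & acts_properly_discontinuously Gamma].

Definition abelian_mxset (R : realType) (n : nat) (H : set 'M[R]_n) : Prop :=
  forall L1 L2, H L1 -> H L2 -> L1 *m L2 = L2 *m L1.

(* C^oo on an open set U: every iterated directional derivative is Frechet
   differentiable at every point of U. *)
Fixpoint iter_derive (R : realType) (n : nat) (vs : seq 'cV[R]_n)
    (F : 'cV[R]_n -> 'cV[R]_n) : 'cV[R]_n -> 'cV[R]_n :=
  if vs is v :: vs' then fun x => 'D_v (iter_derive vs' F) x else F.

Definition smooth_on (R : realType) (n : nat) (U : set 'cV[R]_n)
    (F : 'cV[R]_n -> 'cV[R]_n) : Prop :=
  forall vs x, U x -> differentiable (iter_derive vs F) x.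

Section Quotient.
Variables (R : realType) (n : nat) (B : 'M[R]_n) (Gamma : set (affine R n)).

Definition orbit_of (x : 'cV[R]_n) : set 'cV[R]_n :=
  [set y | exists2 g, Gamma g & y = aff_act g x].

Definition quotient_space : Type :=
  {X : set 'cV[R]_n | exists x, X = orbit_of x}.

Definition quotient_proj (x : 'cV[R]_n) : quotient_space :=
  exist _ (orbit_of x) (ex_intro _ x erefl).

(* The projection R^n -> R^n / Gamma is a local isometry, so differential
   properties of a self-map f of R^n / Gamma are read on its local lifts. *)
Definition local_lift (f : quotient_space -> quotient_space)
    (U : set 'cV[R]_n) (F : 'cV[R]_n -> 'cV[R]_n) : Prop :=
  forall u, U u -> quotient_proj (F u) = f (quotient_proj u).

Definition smooth_map (f : quotient_space -> quotient_space) : Prop :=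
  forall x : 'cV[R]_n, exists (U : set 'cV[R]_n) (F : 'cV[R]_n -> 'cV[R]_n),
    [/\ open U, U x, local_lift f U F & smooth_on U F].

Definition preserves_metric (f : quotient_space -> quotient_space) : Prop :=
  forall (U : set 'cV[R]_n) (F : 'cV[R]_n -> 'cV[R]_n),
    open U -> local_lift f U F -> smooth_on U F ->
    forall u v w, U u -> bform B ('d F u v) ('d F u w) = bform B v w.

Definition quotient_isometry (f : quotient_space -> quotient_space) : Prop :=
  exists finv : quotient_space -> quotient_space,
    [/\ cancel f finv, cancel finv f, smooth_map f, smooth_map finv
      & preserves_metric f].

Definition homogeneous : Prop :=
  forall p q : quotient_space, exists2 f, quotient_isometry f & f p = q.

End Quotient.

(* Main.v *)
(* For [g] in [Gamma] put [d_g x = g x - x]. An isometry of the quotient lifts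
   to an affine isometry [phi] with [phi g = g' phi], [g'] in [Gamma], so
   [<d_g, d_h> x = <d_g', d_h'> (phi x)]. By homogeneity all values of the
   quadratic function [<d_g, d_h>] are among its values for pairs of elements
   of [Gamma] at the points of a single orbit; as [Gamma] is countable, the
   function is constant.

   For [g_i = (I + A_i, v_i)] constancy says that [A_i] is skew, [A_i^2 = 0],
   [A_i v_i = 0], [A1 A2 = - A2 A1] and [A1 v2 = - A2 v1]. Let
   [A1 A2 <> A2 A1]. The commutator [(I + 2 A1 A2, 2 A1 v2)] has no fixed
   point, so [A1 v2] is not in the image of [A1 A2], and there is [z] with
   [A1 A2 z = 0] and [<A1 v2, z> <> 0]. If [<y, A1 A2 x> <> 0], the vectors
   [A1 z, A2 x, A2 y, A2 z, A1 v2, A1 A2 x, A1 A2 y] span a totally isotropic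
   subspace, and they are independent because their products with
   [v2, A1 y, A1 x, v1, z, y, x] form a triangular matrix. Hence [s >= 7]. *)

Require Import Defs.
From HB Require Import structures.
From mathcomp Require Import all_boot all_order all_algebra.
From mathcomp Require Import all_classical all_reals all_analysis.
From mathcomp Require Import ring lra zify.
Import numFieldNormedType.Exports.

Set Implicit Arguments.
Unset Strict Implicit.
Unset Printing Implicit Defensive.

Import Order.TTheory GRing.Theory Num.Theory.
Local Open Scope classical_set_scope.
Local Open Scope ring_scope.

(** * Bilinear forms and isotropic subspaces *)

Lemma mulmx_cV_inj (R : pzRingType) (m n : nat) (M N : 'M[R]_(m, n)) :
  (forall x : 'cV[R]_n, M *m x = N *m x) -> M = N.
Proof.
move=> MN; apply/matrixP => i j.
by have := congr1 (fun v : 'cV_m => v i 0) (MN (delta_mx j 0));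
  rewrite -!colE !mxE.
Qed.

Section BilinearForm.
Variables (R : realType) (n : nat) (B : 'M[R]_n).
Implicit Types (x y z : 'cV[R]_n) (L : 'M[R]_n).

Lemma bform_delta i j : bform B (delta_mx i 0) (delta_mx j 0) = B i j.
Proof. by rewrite /bform trmx_delta -rowE -colE !mxE. Qed.

Lemma bform_mulmx m (L : 'M[R]_(n, m)) (x y : 'cV[R]_m) :
  bform B (L *m x) (L *m y) = bform (L^T *m B *m L) x y.
Proof. by rewrite /bform trmx_mul !mulmxA. Qed.

Lemma bformDl x y z : bform B (x + y) z = bform B x z + bform B y z.
Proof. by rewrite /bform linearD/= !mulmxDl mxE. Qed.

Lemma bformDr x y z : bform B x (y + z) = bform B x y + bform B x z.
Proof. by rewrite /bform mulmxDr mxE. Qed.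

Lemma bformZl a x y : bform B (a *: x) y = a * bform B x y.
Proof. by rewrite /bform linearZ/= -!scalemxAl mxE. Qed.

Lemma bformZr a x y : bform B x (a *: y) = a * bform B x y.
Proof. by rewrite /bform -!scalemxAr mxE. Qed.

Lemma bformNl x y : bform B (- x) y = - bform B x y.
Proof. by rewrite -scaleN1r bformZl mulN1r. Qed.

Lemma bformNr x y : bform B x (- y) = - bform B x y.
Proof. by rewrite -scaleN1r bformZr mulN1r. Qed.

Lemma bform0l x : bform B 0 x = 0.
Proof. by rewrite /bform trmx0 !mul0mx mxE. Qed.

Lemma bform0r x : bform B x 0 = 0.
Proof. by rewrite /bform mulmx0 mxE. Qed.

Lemma bform_nondegenerate x : B \in unitmx ->
  (forall y, bform B y x = 0) -> x = 0.
Proof.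
move=> Bu h; have Bx0 : B *m x = 0.
  apply/matrixP => i j; rewrite ord1 [RHS]mxE -(h (delta_mx i 0)) /bform.
  by rewrite -mulmxA trmx_delta -rowE [RHS]mxE.
by rewrite -(mulKmx Bu x) Bx0 mulmx0.
Qed.

Lemma bformC x y : B^T = B -> bform B x y = bform B y x.
Proof.
move=> BT; rewrite /bform -[y^T *m B *m x]trmxK [RHS]mxE.
by rewrite !trmx_mul trmxK BT mulmxA.
Qed.

End BilinearForm.

Lemma isometry_unitmx (R : realType) (n : nat) (B L : 'M[R]_n) : B \in unitmx ->
  (forall x y, bform B (L *m x) (L *m y) = bform B x y) -> L \in unitmx.
Proof.
move=> Bu isoL; have LBL : L^T *m B *m L = B.
  apply/matrixP => i j.
  by have := isoL (delta_mx i 0) (delta_mx j 0); rewrite bform_mulmx !bform_delta.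
by move: Bu; rewrite -{1}LBL unitmx_mul => /andP[].
Qed.

(** The diagonal matrix [D] congruent to [B] is symmetric and its own inverse, and both properties
    pass back through the invertible [P]. *)
Lemma has_signature_nondegenerate (R : realType) (n : nat) (B : 'M[R]_n) p q :
  has_signature B p q -> B^T = B /\ B \in unitmx.
Proof.
move=> [_ [P Pu]]; set D := diag_mx _ => PBP.
have PTu : P^T \in unitmx by rewrite unitmx_tr.
split.
  apply: (can_inj (mulKmx PTu)); apply: (can_inj (mulmxK Pu)) => /=.
  by rewrite PBP -[D]tr_diag_mx -/D -PBP !trmx_mul trmxK mulmxA.
have : D *m D = 1%:M.
  apply/matrixP => i j; rewrite mulmx_diag !mxE; case: eqP => [->|//].
  by case: ifP; rewrite ?mulr1// mulrNN mulr1.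
by move=> /mulmx1_unit[+ _]; rewrite -PBP !unitmx_mul => /andP[/andP[]].
Qed.

(** If the last [q] coordinates of a vector in the basis [P] vanish, its square is the sum of the
    squares of the other coordinates, so it is zero when isotropic. For [m > q] some nontrivial
    combination of the columns of [V] is such a vector. *)
Lemma isotropic_rank_le (R : realType) (n : nat) (B : 'M[R]_n) p q m
    (V : 'M[R]_(n, m)) :
  has_signature B p q -> V^T *m B *m V = 0 ->
  (forall c : 'cV[R]_m, V *m c = 0 -> c = 0) -> (m <= q)%N.
Proof.
move=> [pqn [P Pu PBP]] Viso Vinj.
case: leqP => // qm.
pose Y := invmx P *m V.
pose N := \matrix_(i < q, j < m) Y (cast_ord pqn (rshift p i)) j.
have : (0 < \rank (kermx N^T))%N.
  rewrite mxrank_ker subn_gt0 (leq_ltn_trans _ qm)// mxrank_tr.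
  exact: rank_leq_row.
(* The rows of [kermx N^T] are the transposes of vectors [c] killed by [N]; each will turn out to be
   zero. *)
rewrite lt0n mxrank_eq0 => /eqP; case.
apply/matrixP => k l; rewrite [RHS]mxE.
pose c := (row k (kermx N^T))^T.
suff c0 : c = 0 by have := congr1 (fun M : 'cV_m => M l 0) c0; rewrite !mxE.
apply: Vinj.
have Nc : N *m c = 0.
  by apply: trmx_inj; rewrite trmx_mul trmxK -row_mul mulmx_ker row0 trmx0.
pose y := Y *m c.
have yq (i : 'I_n) : ~~ (i < p)%N -> y i 0 = 0.
  move=> ip; have iq : (i - p < q)%N.
    by have := ltn_ord i; move=> ltin; lia.
  transitivity ((N *m c) (Ordinal iq) 0); last by rewrite Nc mxE.
  rewrite !mxE; apply: eq_bigr => j _; rewrite [N _ _]mxE; congr (Y _ j * _).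
  by apply: val_inj => /=; move: ip; rewrite -leqNgt => /subnKC.
have y0 : y^T *m diag_mx (\row_(i < n) (if (i < p)%N then 1 else -1)) *m y = 0.
  rewrite -PBP /y /Y trmx_mul trmx_mul !mulmxA.
  rewrite trmx_inv -(mulmxA _ (invmx P^T)) mulVmx ?unitmx_tr// mulmx1.
  rewrite -(mulmxA _ P) mulmxV// mulmx1 -(mulmxA c^T) -(mulmxA c^T).
  by rewrite Viso mulmx0 mul0mx.
have yy : \sum_i (y i 0) ^+ 2 = 0.
  transitivity ((y^T *m diag_mx
      (\row_(i < n) (if (i < p)%N then 1 else -1)) *m y) 0 0); last first.
    by rewrite y0 mxE.
  rewrite mxE; apply: eq_bigr => i _.
  rewrite mul_mx_diag !mxE; case: ifPn => [_|/yq]; first by rewrite mulr1 expr2.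
  by rewrite !mxE => ->; rewrite mulr0 expr2 mul0r.
have yz : y = 0.
  apply/matrixP => i j; rewrite ord1 [RHS]mxE; apply/eqP.
  move/eqP: yy; rewrite psumr_eq0 => [|k' _]; last exact: sqr_ge0.
  by move=> /allP/(_ i); rewrite mem_index_enum/= sqrf_eq0; exact.
have -> : V = P *m Y by rewrite mulKVmx.
by rewrite -mulmxA -/y yz mulmx0.
Qed.

(** * Constant displacement products *)

(** Pairing the relation with [t i] leaves only the terms with j <= i, and those with j < i vanish
    by induction. *)
Lemma triangular_free (R : realType) (n m : nat) (B : 'M[R]_n)
    (t u : 'I_m -> 'cV[R]_n) (c : 'I_m -> R) :
  (forall i, bform B (t i) (u i) != 0) ->
  (forall i j : 'I_m, (i < j)%N -> bform B (t i) (u j) = 0) ->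
  \sum_j c j *: u j = 0 -> forall i, c i = 0.
Proof.
move=> tu_neq0 tu0 cu0.
suff H k : forall i : 'I_m, (i < k)%N -> c i = 0 by move=> i; exact: (H i.+1).
elim: k => // k IH i; rewrite ltnS leq_eqVlt => /predU1P[ik|]; last exact: IH.
have : bform B (t i) (\sum_j c j *: u j) = 0 by rewrite cu0 bform0r.
rewrite (big_morph (bform B (t i)) (bformDr B (t i)) (bform0r B (t i))).
rewrite (bigD1 i)//= bformZr big1 => [|j ji].
  by rewrite addr0 => /eqP; rewrite mulf_eq0 (negPf (tu_neq0 i)) orbF => /eqP.
rewrite bformZr; have [ltij|leji] := ltnP i j; first by rewrite tu0// mulr0.
by rewrite IH ?mul0r// -ik ltn_neqAle leji andbT.
Qed.

Lemma isotropic_family_le (R : realType) (n p q m : nat) (B : 'M[R]_n)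
    (t u : 'I_m -> 'cV[R]_n) :
  has_signature B p q ->
  (forall i j, bform B (u i) (u j) = 0) ->
  (forall i, bform B (t i) (u i) != 0) ->
  (forall i j : 'I_m, (i < j)%N -> bform B (t i) (u j) = 0) ->
  (m <= q)%N.
Proof.
move=> Bpq uu tu_neq0 tu0; pose V := \matrix_(i < n, j < m) u j i 0.
have Vdelta j : V *m delta_mx j 0 = u j.
  by rewrite -colE; apply/matrixP => i k; rewrite ord1 !mxE.
apply: (@isotropic_rank_le _ _ _ _ _ _ V Bpq).
  apply/matrixP => i j; rewrite -bform_delta -bform_mulmx !Vdelta uu.
  by rewrite mxE.
move=> c Vc; apply/matrixP => i j; rewrite ord1 [RHS]mxE.
apply: (triangular_free (c := fun i => c i 0) tu_neq0 tu0).
rewrite -[RHS]Vc; apply/matrixP => k l; rewrite ord1 summxE !mxE.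
by apply: eq_bigr => j' _; rewrite !mxE mulrC.
Qed.

(* A vector outside the image of a skew-adjoint [K] is detected by the kernel
   of [K], which is the orthogonal complement of that image. *)
Lemma notin_image_skew (R : realType) (n : nat) (B K : 'M[R]_n) (u : 'cV[R]_n) :
  B^T = B -> B \in unitmx ->
  (forall x y, bform B (K *m x) y = - bform B x (K *m y)) ->
  (forall x, K *m x != u) -> exists2 z, K *m z = 0 & bform B u z != 0.
Proof.
move=> BT Bu Kskew Ku.
have uK : ~~ (u^T <= K^T)%MS.
  apply/negP => /submxP[D /(congr1 trmx)]; rewrite trmx_mul !trmxK => uE.
  by have := Ku D^T; rewrite -uE eqxx.
have [j uj] : exists j, (u^T *m cokermx K^T) 0 j != 0.
  apply/existsP; apply: contraNT uK => /existsPn uK0; rewrite submxE.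
  apply/eqP/matrixP => i j; rewrite ord1 [RHS]mxE; apply/eqP.
  by have := uK0 j; rewrite negbK.
(* Here [K^T *m r = 0] and [u^T *m r] is nonzero; the inverse of [B] turns the dot product with [r]
   into the product with [z] for [B]. *)
pose r := col j (cokermx K^T); pose z := invmx B *m r.
have Bz : B *m z = r by rewrite mulKVmx.
exists z; last by rewrite /bform -mulmxA Bz /r colE mulmxA -colE mxE.
apply: (bform_nondegenerate Bu) => y.
rewrite -[LHS]opprK -Kskew /bform -mulmxA Bz trmx_mul -mulmxA.
by rewrite /r colE (mulmxA K^T) mulmx_coker mul0mx mulmx0 mxE oppr0.
Qed.

Section ConstantDisplacement.
Variables (R : realType) (n : nat) (B : 'M[R]_n).
Hypotheses (BT : B^T = B) (Bu : B \in unitmx).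
Implicit Types (A : 'M[R]_n) (v x y : 'cV[R]_n).

(** The quadratic and the linear part in [x] add up to zero; passing to [- x] changes the sign of
    the linear part only. *)
Lemma displacement_split A1 A2 v1 v2 :
  (forall x, bform B (A1 *m x + v1) (A2 *m x + v2) = bform B v1 v2) ->
  (forall x, bform B (A1 *m x) (A2 *m x) = 0) /\
  (forall x, bform B (A1 *m x) v2 + bform B v1 (A2 *m x) = 0).
Proof.
move=> h; have E x : bform B (A1 *m x) (A2 *m x) + (bform B (A1 *m x) v2 +
    bform B v1 (A2 *m x)) = 0.
  by have := h x; rewrite bformDl !bformDr; lra.
by split=> x; have := E x; have := E (- x);
  rewrite !mulmxN !bformNl !bformNr; lra.
Qed.

(** Polarizing the quadratic part makes the image of [A] totally isotropic, which reduces the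
    isometry condition to skewness. Non-degeneracy then gives [A *m A = 0], and the linear part
    gives [A *m v = 0]. *)
Lemma displacement_skew A v :
  (forall x y, bform B ((1%:M + A) *m x) ((1%:M + A) *m y) = bform B x y) ->
  (forall x, bform B (A *m x + v) (A *m x + v) = bform B v v) ->
  [/\ forall x y, bform B (A *m x) y = - bform B x (A *m y),
      forall x y, bform B (A *m x) (A *m y) = 0, A *m A = 0 & A *m v = 0].
Proof.
move=> iso /displacement_split[q0 l0].
have AA x y : bform B (A *m x) (A *m y) = 0.
  have := q0 (x + y); rewrite mulmxDr bformDl !bformDr !q0.
  by rewrite (bformC (A *m y) _ BT); lra.
have skew x y : bform B (A *m x) y = - bform B x (A *m y).
  have := iso x y; rewrite !mulmxDl !mul1mx bformDl !bformDr AA; lra.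
split=> //.
  apply: mulmx_cV_inj => x; rewrite mul0mx.
  apply: (bform_nondegenerate Bu) => y.
  by rewrite -mulmxA -[LHS]opprK -skew AA oppr0.
apply: (bform_nondegenerate Bu) => y.
rewrite -[LHS]opprK -skew.
by have := l0 y; rewrite (bformC v _ BT); lra.
Qed.

(** Both identities come from non-degeneracy, after skewness moves [A1] and [A2] to one side: the
    first from the polarized quadratic part, the second from the linear part. *)
Lemma displacement_anticomm A1 A2 v1 v2 :
  (forall x y, bform B (A1 *m x) y = - bform B x (A1 *m y)) ->
  (forall x y, bform B (A2 *m x) y = - bform B x (A2 *m y)) ->
  (forall x, bform B (A1 *m x + v1) (A2 *m x + v2) = bform B v1 v2) ->
  A2 *m A1 = - (A1 *m A2) /\ A2 *m v1 = - (A1 *m v2).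
Proof.
move=> sk1 sk2 /displacement_split[q0 l0]; split.
  apply/eqP; rewrite -addr_eq0; apply/eqP.
  apply: mulmx_cV_inj => x; rewrite mul0mx.
  apply: (bform_nondegenerate Bu) => y.
  rewrite mulmxDl -!mulmxA bformDr.
  rewrite -[bform B y (A2 *m _)]opprK -(sk2 y).
  rewrite -[bform B y (A1 *m _)]opprK -(sk1 y).
  have := q0 (x + y); rewrite !mulmxDr bformDl !bformDr !q0.
  by rewrite (bformC (A1 *m x) _ BT); lra.
apply/eqP; rewrite -addr_eq0; apply/eqP.
apply: (bform_nondegenerate Bu) => y; rewrite bformDr.
rewrite -[bform B y (A2 *m _)]opprK -(sk2 y).
  rewrite -[bform B y (A1 *m _)]opprK -(sk1 y).
by have := l0 y; rewrite (bformC v1 _ BT); lra.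
Qed.

End ConstantDisplacement.

(** The last hypothesis says that the two products of (I + A1, v1) and (I + A2, v2) agree at no
    point, that is, that their commutator has no fixed point. *)
Lemma noncommuting_index_ge7 (R : realType) (n p s : nat) (B A1 A2 : 'M[R]_n)
    (v1 v2 : 'cV[R]_n) :
  has_signature B p s ->
  (forall x y, bform B ((1%:M + A1) *m x) ((1%:M + A1) *m y) = bform B x y) ->
  (forall x y, bform B ((1%:M + A2) *m x) ((1%:M + A2) *m y) = bform B x y) ->
  (forall x, bform B (A1 *m x + v1) (A1 *m x + v1) = bform B v1 v1) ->
  (forall x, bform B (A2 *m x + v2) (A2 *m x + v2) = bform B v2 v2) ->
  (forall x, bform B (A1 *m x + v1) (A2 *m x + v2) = bform B v1 v2) ->
  A1 *m A2 <> A2 *m A1 ->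
  (forall x, (A1 *m A2) *m x + A1 *m v2 <> (A2 *m A1) *m x + A2 *m v1) ->
  (7 <= s)%N.
Proof.
move=> sB iso1 iso2 c11 c22 c12 nAA nfix.
have [BT Bu] := has_signature_nondegenerate sB.
have [sk1 q1 sq1 A1v1] := displacement_skew BT Bu iso1 c11.
have [sk2 q2 sq2 A2v2] := displacement_skew BT Bu iso2 c22.
have [A21 A2v1] := displacement_anticomm BT Bu sk1 sk2 c12.
have bC := bformC _ _ BT.
have skK x y : bform B (A1 *m A2 *m x) y = - bform B x (A1 *m A2 *m y).
  by rewrite -!mulmxA sk1 sk2 opprK (mulmxA A2) A21 mulNmx bformNr mulmxA.
have [z A12z ez] :
    exists2 z, A1 *m A2 *m z = 0 & bform B (A1 *m v2) z != 0.
  apply: notin_image_skew => // x; apply/eqP => xE.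
  (* If [A1 *m A2 *m x = A1 *m v2], both sides of [nfix] vanish at [- x]. *)
  by apply: (nfix (- x)); rewrite A21 A2v1 !mulmxN mulNmx opprK xE addrC.
have [x [y xy]] : exists x y, bform B y (A1 *m A2 *m x) != 0.
  apply: contrapT => /forallNP nx; apply: nAA.
  suff K0 : A1 *m A2 = 0 by rewrite A21 K0 oppr0.
  apply: mulmx_cV_inj => x; rewrite mul0mx.
  apply: (bform_nondegenerate Bu) => y.
  by have /forallNP/(_ y)/negP := nx x; rewrite negbK => /eqP.
have alt w : bform B w (A1 *m A2 *m w) = 0.
  by have := skK w w; rewrite bC; lra.
have A1A1 w : A1 *m (A1 *m w) = 0 by rewrite mulmxA sq1 mul0mx.
have A2A2 w : A2 *m (A2 *m w) = 0 by rewrite mulmxA sq2 mul0mx.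
have A12v2 : A1 *m A2 *m v2 = 0 by rewrite -mulmxA A2v2 mulmx0.
(* The left side equals the product of [A1 *m A2 *m p'] with [w]. This is used with [p'] equal to
   [z], to [v2] or to a vector in the image of [A2]. *)
have cross p' w : A1 *m A2 *m p' = 0 -> bform B (A1 *m p') (A2 *m w) = 0.
  by move=> p0; rewrite sk1 mulmxA -[RHS](bform0l B w) -p0 skK.
have cross' p' w : A1 *m A2 *m p' = 0 -> bform B (A2 *m w) (A1 *m p') = 0.
  by move=> p0; rewrite bC cross.
have crossK w : A1 *m A2 *m (A2 *m w) = 0 by rewrite -mulmxA A2A2 mulmx0.
(* Each entry of [us] lies in the image of [A2] or is [A1 *m p'] with [p'] as in [cross], so their
   span is totally isotropic. The order makes the products with [ts] triangular; up to sign, the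
   diagonal consists of the nonzero numbers in [ez] and [xy]. *)
pose us := [:: A1 *m z; A2 *m x; A2 *m y; A2 *m z; A1 *m v2;
               A1 *m (A2 *m x); A1 *m (A2 *m y)].
pose ts := [:: v2; A1 *m y; A1 *m x; v1; z; y; x].
have v2A2 w : bform B v2 (A2 *m w) = 0.
  by rewrite -[LHS]opprK -sk2 A2v2 bform0l oppr0.
have v1A1 w : bform B v1 (A1 *m w) = 0.
  by rewrite -[LHS]opprK -sk1 A1v1 bform0l oppr0.
have v2A1v2 : bform B v2 (A1 *m v2) = 0.
  by have := sk1 v2 v2; rewrite bC; lra.
have v2K w : bform B v2 (A1 *m (A2 *m w)) = 0.
  by rewrite -[LHS]opprK -sk1 cross// oppr0.
have zK w : bform B z (A1 *m (A2 *m w)) = 0.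
  by rewrite -[LHS]opprK -sk1 cross// oppr0.
apply: (@isotropic_family_le _ _ _ _ 7 _
  (fun i => nth 0 ts i) (fun i => nth 0 us i) sB).
- by move=> [[|[|[|[|[|[|[|//]]]]]]] ?] [[|[|[|[|[|[|[|//]]]]]]] ?];
    rewrite /= ?q1 ?q2 ?cross ?cross'.
- have xy' : bform B x (A1 *m A2 *m y) != 0 by rewrite -oppr_eq0 -skK bC.
  move=> [[|[|[|[|[|[|[|//]]]]]]] ?]; rewrite /=.
  + by rewrite -oppr_eq0 -sk1.
  + by rewrite sk1 oppr_eq0 mulmxA.
  + by rewrite sk1 oppr_eq0 mulmxA.
  + by rewrite -oppr_eq0 -sk2 A2v1 bformNl oppr_eq0.
  + by rewrite bC.
  + by rewrite mulmxA.
  + by rewrite mulmxA.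
- move=> [[|[|[|[|[|[|[|//]]]]]]] ?] [[|[|[|[|[|[|[|//]]]]]]] ?]//= _;
    rewrite ?q1 ?q2 ?v2A2 ?v1A1 ?v2K ?zK //.
  + by rewrite sk1 mulmxA alt oppr0.
  + by rewrite sk1 mulmxA A12z bform0r oppr0.
  + by rewrite sk1 mulmxA A12z bform0r oppr0.
  + by rewrite mulmxA alt.
Qed.

(** * Countable families of affine maps *)

(* Gives matrices the complete normed module structure that [Baire] needs. *)
HB.instance Definition _ (R : realType) (m n : nat) :=
  Complete.on 'M[R]_(m, n).

Section AffineTopology.
Variables (R : realType) (n : nat).
Implicit Types (g h : affine R n) (x u : 'cV[R]_n).

Lemma continuous_mulmx m (M : 'M[R]_(m, n)) : continuous (fun x => M *m x).
Proof.
move=> x.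
have -> : (fun x => M *m x) = \sum_(j < n) (fun x => x j 0 *: col j M).
  apply/funext => y; rewrite fct_sumE; apply/matrixP => i k.
  by rewrite ord1 !mxE summxE; apply: eq_bigr => j _; rewrite !mxE mulrC.
apply: (@big_ind _ (fun f : 'cV[R]_n -> 'cV[R]_m => {for x, continuous f})).
- exact: cst_continuous.
- by move=> f f' fx f'x; exact: continuousD.
- by move=> j _; apply: continuousZl; exact: coord_continuous.
Qed.

Lemma continuous_aff_act g : continuous (aff_act g).
Proof.
by move=> x; apply: continuousD; [exact: continuous_mulmx|exact: cst_continuous].
Qed.

Lemma continuous_line (x u : 'cV[R]_n) : continuous (fun t : R => t *: u + x).
Proof.
move=> t; apply: cvgD; last exact: cvg_cst.
by apply: cvgZr_tmp; exact: cvg_id.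
Qed.

(** Comparing the values at [u0] and at [t *: x + u0] for a small nonzero [t] recovers the linear
    part at [x]. *)
Lemma affine_eq_open g h (W : set 'cV[R]_n) : open W -> W !=set0 ->
  (forall u, W u -> aff_act g u = aff_act h u) -> g = h.
Proof.
case: g h => [L v] [L' v']; move=> Wo [u0 Wu0] gh.
have LL x : L *m x = L' *m x.
  have : \forall t \near (0 : R)^', W (t *: x + u0).
    apply: nbhs_dnbhs; have := @continuous_line u0 x 0.
    by apply; rewrite scale0r add0r; exact: open_nbhs_nbhs.
  move=> Wt; have : \forall t \near (0 : R)^', t != 0 /\ W (t *: x + u0).
    by near=> t; split; [near: t; exact: nbhs_dnbhs_neq|near: t].
  move=> /(@filter_ex _ _ _)[t [t0 /gh]].
  have := gh _ Wu0; rewrite /aff_act/= !mulmxDr -!addrA => ->.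
  by move=> /addIr; rewrite -!scalemxAr => /(scalerI t0).
have LE : L = L' by exact: mulmx_cV_inj.
by have := gh _ Wu0; rewrite /aff_act/= LE => /addrI ->.
Unshelve. all: by end_near. Qed.

(** This replaces an element of [G] chosen at each point by a single one. If [h] is not in [G], each
    [g] in [G] differs from [h] on a dense open set; by Baire these countably many sets have a
    common point in [W], against the hypothesis. *)
Lemma countable_affine_cover (G : set (affine R n)) h (W : set 'cV[R]_n) :
  countable G -> open W -> W !=set0 ->
  (forall u, W u -> exists2 g, G g & aff_act g u = aff_act h u) -> G h.
Proof.
move=> Gc Wo W0 GW; apply: contrapT => nGh.
move/countable_injP : Gc => [e einj].
(* The sets are indexed by natural numbers through [e]; an index not attained on [G] gives the whole
   space. *)
pose F i := [set u | forall g, G g -> e g = i -> aff_act g u <> aff_act h u].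
have FE g : G g -> F (e g) = ~` [set u | aff_act g u - aff_act h u = 0].
  move=> Gg; apply/seteqP; split=> u /=.
    by move=> /(_ g Gg erefl) gh /subr0_eq.
  move=> gh g' Gg' /einj; rewrite !inE => /(_ Gg' Gg) ->.
  by move=> E; apply: gh; rewrite E subrr.
have F0 i : ~ (exists2 g, G g & e g = i) -> F i = setT.
  by move=> ni; apply/seteqP; split=> u //= _ g Gg egi; case: ni; exists g.
have Fod i : open (F i) /\ dense (F i).
  have [[g Gg <-]|/F0 ->] := pselect (exists2 g, G g & e g = i); last first.
    by split; [exact: openT|move=> O O0 _; rewrite setIT].
  rewrite FE//; split.
    rewrite openC.
    apply: (@preimage_closed _ _ (fun u => aff_act g u - aff_act h u) [set 0]).
      by move=> u _; apply: continuousB; exact: (@continuous_aff_act _ u).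
    by apply: accessible_closed_set1; apply: hausdorff_accessible;
      exact: norm_hausdorff.
  move=> O O0 Oo; apply: contrapT => /set0P/negP; rewrite negbK => /eqP O0'.
  apply: nGh; rewrite -(@affine_eq_open g h O Oo O0)// => u Ou.
  apply: contrapT => gh; have : set0 u by rewrite -O0'; split=> // /subr0_eq.
  by [].
have [u [/GW[g Gg gu] /(_ (e g) I)]] := Baire Fod W0 Wo.
by move=> /(_ g Gg erefl).
Qed.

End AffineTopology.

Lemma compact_cube (R : realType) (n : nat) (r : R) :
  compact [set x : 'cV[R]_n | forall i, `|x i 0| <= r].
Proof.
have -> : [set x : 'cV[R]_n | forall i, `|x i 0| <= r] =
    trmx @` [set v : 'rV[R]_n | forall i, `[- r, r]%classic (v ord0 i)].
  apply/seteqP; split=> [x /= xr|_ /= [v vr <-] i].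
    exists x^T; last by rewrite trmxK.
    by move=> i /=; rewrite in_itv/= mxE -ler_norml.
  by have := vr i; rewrite /= in_itv/= mxE -ler_norml.
apply: continuous_compact; last first.
  by apply: (@rV_compact _ _ (fun=> `[- r, r]%classic)) => i; exact: segment_compact.
apply: continuous_subspaceT => v.
have -> : @trmx R 1 n = fun v => \sum_(j < n) (v ord0 j *: delta_mx j 0).
  apply/funext => y; apply/matrixP => i k.
  rewrite ord1 mxE summxE (bigD1 i)//= !mxE !eqxx/= mulr1 big1 ?addr0// => j ji.
  by rewrite !mxE eq_sym (negPf ji)/= mulr0.
have -> : (fun v : 'rV[R]_n => \sum_(j < n) (v ord0 j *: delta_mx j 0 : 'cV[R]_n))
    = \sum_(j < n) (fun v : 'rV[R]_n => v ord0 j *: delta_mx j 0).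
  by apply/funext => y; rewrite fct_sumE.
apply: (@big_ind _ (fun f : 'rV[R]_n -> 'cV[R]_n => {for v, continuous f})).
- exact: cst_continuous.
- by move=> f f' fx f'x; exact: continuousD.
- by move=> j _; apply: continuousZl; exact: coord_continuous.
Qed.

(** A cube that contains both 0 and its image under [g] meets its own image. So the finite sets
    attached to the cubes [K m] exhaust [Gamma]. *)
Lemma properly_discontinuous_countable (R : realType) (n : nat)
    (Gamma : set (affine R n)) :
  acts_properly_discontinuously Gamma -> countable Gamma.
Proof.
move=> pd; pose K (m : nat) := [set x : 'cV[R]_n | forall i, `|x i 0| <= m%:R].
have -> : Gamma = \bigcup_m
    [set g | Gamma g /\ (aff_act g @` K m) `&` K m !=set0].
  apply/seteqP; split=> [g Gg|g [m _ []]//].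
  have [m gm] : exists m : nat, K m (aff_act g 0).
    exists (Num.truncn (\sum_i `|aff_act g 0 i 0|)).+1 => i.
    apply: le_trans (ltW (truncnS_gt _)).
    by rewrite (bigD1 i)//= lerDl sumr_ge0.
  exists m => //; split=> //; exists (aff_act g 0); split=> //.
  by exists 0 => // i; rewrite mxE normr0.
apply: bigcup_countable => // m _; apply: finite_set_countable.
exact/pd/compact_cube.
Qed.

(** By the intermediate value theorem a non-constant [f] would take all values of an interval of
    positive Lebesgue measure, while countable sets are null. *)
Lemma countable_range_cst (R : realType) (f : R -> R) (C : set R) :
  continuous f -> countable C -> (forall x, C (f x)) -> forall a b, f a = f b.
Proof.
move=> fc Cc Cf.
suff H a b : a <= b -> f a = f b.
  by move=> a b; have [/H//|/ltW/H] := leP a b.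
move=> ab; apply/eqP; apply: contrapT => /negP fab.
pose l := Num.min (f a) (f b); pose u := Num.max (f a) (f b).
have lu : l < u.
  move: fab; rewrite /l /u neq_lt => /orP[] h.
    by rewrite (min_idPl (ltW h)) (max_idPr (ltW h)).
  by rewrite (min_idPr (ltW h)) (max_idPl (ltW h)).
have sub : `[l, u]%classic `<=` C.
  move=> v; rewrite /= in_itv/= => vlu.
  have [|c _ <-//] := @IVT _ f a b v ab _ vlu.
  exact: continuous_subspaceT.
have := countable_lebesgue_measure0 (sub_countable (subset_card_le sub) Cc).
rewrite lebesgue_measure_itv/= lte_fin lu -EFinB => -[] /eqP.
by rewrite subr_eq0 gt_eqF.
Qed.

(** Restricting to the line through a point of [S] and an arbitrary point reduces this to the
    connectedness of the real line. *)
Lemma clopen_cV (R : realType) (n : nat) (S : set 'cV[R]_n) :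
  clopen S -> S !=set0 -> S = setT.
Proof.
move=> Sco [x Sx]; apply/seteqP; split=> // y _.
have lc : continuous (fun t : R => t *: (y - x) + x) := @continuous_line _ _ x (y - x).
have [Eo Ec] : clopen ((fun t : R => t *: (y - x) + x) @^-1` S).
  exact: preimage_clopen.
have RC : connected [set: R] by apply/connected_intervalP => a b.
have : (fun t : R => t *: (y - x) + x) @^-1` S = setT.
  apply: RC.
  - by exists 0; rewrite /= scale0r add0r.
  - by eexists; [exact: Eo|rewrite setTI].
  - by eexists; [exact: Ec|rewrite setTI].
by move=> /seteqP[_ /(_ 1 I)]; rewrite /= scale1r subrK.
Qed.

(** * Local isometries are affine *)

Section SymmetryOfSecondDerivatives.
Variables (R : realType) (V : normedModType R).
Implicit Types (f fa fb fab fba df : V -> R) (x y z a b v : V).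

Lemma is_derive_shift_line f c z a (d : R) :
  is_derive (c + z) a f d -> is_derive z a (fun y => f (c + y)) d.
Proof.
move=> [fd fdE].
have E : (fun h : R => h^-1 *: (((fun y => f (c + y)) \o shift z) (h *: a)
    - f (c + z))) =
  (fun h => h^-1 *: ((f \o shift (c + z)) (h *: a) - f (c + z))).
  by apply/funext => h; rewrite /= addrCA.
by apply: DeriveDef; [rewrite /derivable E|rewrite -fdE /derive E].
Qed.

Lemma is_derive_line f z a (s d : R) : is_derive (s *: a + z) a f d ->
  is_derive s 1 (fun t : R => f (t *: a + z)) d.
Proof.
move=> [fd fdE].
have E : (fun h : R => h^-1 *: (((fun t : R => f (t *: a + z)) \o shift s) (h *: 1)
    - f (s *: a + z))) =
  (fun h => h^-1 *: ((f \o shift (s *: a + z)) (h *: a) - f (s *: a + z))).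
  by apply/funext => h; rewrite /= scalerDl addrA [_%:A]mulr1.
by apply: DeriveDef; [rewrite /derivable E|rewrite -fdE /derive E].
Qed.

Lemma mvt_line f df z a (h : R) : 0 <= h ->
  (forall s, 0 <= s <= h -> is_derive (s *: a + z) a f (df (s *: a + z))) ->
  exists2 s, 0 <= s <= h & f (h *: a + z) - f z = h * df (s *: a + z).
Proof.
move=> h0 fd.
have [||s] := @MVT_segment R (fun t => f (t *: a + z))
    (fun t => df (t *: a + z)) 0 h h0.
- move=> s; rewrite in_itv/= => /andP[/ltW s0 /ltW sh].
  by apply: is_derive_line; apply: fd; rewrite s0.
- apply: derivable_within_continuous => s; rewrite in_itv/= => sh.
  by have [] := is_derive_line (fd s sh).
by rewrite in_itv/= => sh; rewrite scale0r add0r subr0 mulrC; exists s.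
Qed.

(** The mean value theorem is applied along [a] to the increment of [f] under translation by
    [h *: b], then along [b] to [fa]. *)
Lemma mvt_square f fa fab x a b (h : R) : 0 <= h ->
  (forall s t, 0 <= s <= h -> 0 <= t <= h ->
    is_derive (s *: a + t *: b + x) a f (fa (s *: a + t *: b + x)) /\
    is_derive (s *: a + t *: b + x) b fa (fab (s *: a + t *: b + x))) ->
  exists s t, [/\ 0 <= s <= h, 0 <= t <= h &
    f (h *: a + h *: b + x) - f (h *: a + x) - f (h *: b + x) + f x =
    h * (h * fab (s *: a + t *: b + x))].
Proof.
move=> h0 fd.
have h0h : 0 <= h <= h by rewrite lexx h0.
have h00 : 0 <= (0 : R) <= h by rewrite lexx h0.
have [|s sh ps] := @mvt_line (fun y => f (h *: b + y) - f y)
    (fun y => fa (h *: b + y) - fa y) x a h h0.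
  move=> s sh; have [d0 _] := fd s 0 sh h00; have [dh _] := fd s h sh h0h.
  rewrite scale0r addr0 in d0; rewrite -addrA addrCA in dh.
  by apply: is_deriveB; apply: is_derive_shift_line.
have [|t th ft] := @mvt_line fa fab (s *: a + x) b h h0.
  by move=> t th; have [_] := fd s t sh th; rewrite -addrA addrCA.
exists s, t; split=> //.
have -> : s *: a + t *: b + x = t *: b + (s *: a + x).
  by rewrite (addrC (s *: a)) addrA.
rewrite -ft -ps -(addrA (h *: a)) (addrCA (h *: a) (h *: b)); ring.
Qed.

(** The second difference of [f] over a small square is symmetric in [a] and [b]. By [mvt_square] it
    is h^2 times a value of [fab] and also h^2 times a value of [fba] on the square, and continuity
    compares these with the values at [x]. *)
Lemma schwarz f fa fb fab fba x a b (U : set V) : open U -> U x ->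
  (forall y, U y -> is_derive y a f (fa y) /\ is_derive y b f (fb y)) ->
  (forall y, U y -> is_derive y b fa (fab y) /\ is_derive y a fb (fba y)) ->
  {for x, continuous fab} -> {for x, continuous fba} ->
  fab x = fba x.
Proof.
move=> Uo Ux d1 d2 cab cba.
apply/eqP; rewrite -subr_eq0 -normr_le0; apply/ler_addgt0Pr => e e0.
rewrite add0r.
have e2 : 0 < e / 2 by rewrite divr_gt0.
have : \forall y \near x, [/\ U y, `|fab x - fab y| <= e / 2
    & `|fba x - fba y| <= e / 2].
  near=> y; split; near: y.
  - exact: open_nbhs_nbhs.
  - by move/cvgrPdist_le : cab; apply.
  - by move/cvgrPdist_le : cba; apply.
move=> /nbhs_ballP[r /= r0 xr].
(* With this side the square stays within distance r / 2 of [x]; the summand 1 keeps the denominator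
   positive when [a] and [b] are zero. *)
pose h := r / (2 * (`|a| + `|b| + 1)).
have ab0 : 0 < `|a| + `|b| + 1 by rewrite ltr_wpDl// addr_ge0.
have h0 : 0 < h by rewrite divr_gt0// mulr_gt0.
have near_xr s t : 0 <= s <= h -> 0 <= t <= h -> ball x r (s *: a + t *: b + x).
  move=> /andP[s0 sh] /andP[t0 th].
  rewrite -ball_normE/= opprD addrCA subrr addr0 normrN.
  rewrite (le_lt_trans (ler_normD _ _))// !normrZ !ger0_norm//.
  apply: (@le_lt_trans _ _ (h * (`|a| + `|b| + 1))).
    by rewrite !mulrDr -[leLHS]addr0 !lerD// ?ler_wpM2r// mulr1 ltW.
  by rewrite /h invfM mulrA -mulrA mulVf ?mulr1 ?gt_eqF//
    ltr_pdivrMr// ltr_pMr// ltr1n.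
have [s [t [sh th E1]]] : exists s t, [/\ 0 <= s <= h, 0 <= t <= h &
    f (h *: a + h *: b + x) - f (h *: a + x) - f (h *: b + x) + f x =
    h * (h * fab (s *: a + t *: b + x))].
  apply: (@mvt_square f fa); first exact: ltW.
  move=> s t sh th; have [Uy _ _] := xr _ (near_xr _ _ sh th).
  by have [? _] := d1 _ Uy; have [? _] := d2 _ Uy.
have [t' [s' [th' sh' E2]]] : exists t s, [/\ 0 <= t <= h, 0 <= s <= h &
    f (h *: b + h *: a + x) - f (h *: b + x) - f (h *: a + x) + f x =
    h * (h * fba (t *: b + s *: a + x))].
  apply: (@mvt_square f fb); first exact: ltW.
  move=> t' s' th' sh'; rewrite (addrC (t' *: b)).
  have [Uy _ _] := xr _ (near_xr _ _ sh' th').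
  by have [_ ?] := d1 _ Uy; have [_ ?] := d2 _ Uy.
have EE : fba (s' *: a + t' *: b + x) = fab (s *: a + t *: b + x).
  apply: (mulfI (lt0r_neq0 h0)); apply: (mulfI (lt0r_neq0 h0)).
  by rewrite -E1 (addrC (s' *: a)) -E2 (addrC (h *: b)); ring.
have [_ + _] := xr _ (near_xr _ _ sh th).
have [_ _ +] := xr _ (near_xr _ _ sh' th').
rewrite EE !ler_distl => /andP[? ?] /andP[? ?].
apply/andP; split; lra.
Unshelve. all: by end_near. Qed.

Lemma is_derive0_ball_cst f x (r : R) :
  (forall y v, ball x r y -> is_derive y v f 0) ->
  forall y, ball x r y -> f y = f x.
Proof.
move=> fd y xry.
have seg s : 0 <= s <= 1 -> ball x r (s *: (y - x) + x).
  move=> /andP[s0 s1]; move: xry; rewrite -!ball_normE/=.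
  rewrite opprD addrCA subrr addr0 normrN normrZ ger0_norm// -normrN opprB.
  by apply: le_lt_trans; rewrite ler_piMl.
have [|s s01] := @mvt_line f (cst 0) x (y - x) 1 ler01.
  by move=> s /seg; exact: fd.
by rewrite scale1r subrK /cst mulr0 => /subr0_eq.
Qed.

End SymmetryOfSecondDerivatives.

Section VectorValuedDerivatives.
Variables (R : realType) (n : nat).
Implicit Types (F : 'cV[R]_n -> 'cV[R]_n) (x y a b v w : 'cV[R]_n).

Lemma is_derive_coord F x v d i : is_derive x v F d ->
  is_derive x v (fun y => F y i 0) (d i 0).
Proof.
move=> [Fd <-]; apply: DeriveDef; first by move/derivable_mxP: Fd; exact.
by rewrite (derive_mx Fd) mxE.
Qed.

Lemma is_derive_bform (B : 'M[R]_n) F G x v dF dG :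
  is_derive x v F dF -> is_derive x v G dG ->
  is_derive x v (fun y => bform B (F y) (G y))
    (bform B dF (G x) + bform B (F x) dG).
Proof.
move=> Fd Gd.
have bE (p q : 'cV[R]_n) : bform B p q = \sum_j \sum_i p i 0 * B i j * q j 0.
  rewrite /bform mxE; apply: eq_bigr => j _; rewrite mxE mulr_suml.
  by apply: eq_bigr => i _; rewrite mxE.
have -> : (fun y => bform B (F y) (G y)) =
    \sum_j \sum_i (fun y => F y i 0 * (B i j *: G y j 0)).
  apply/funext => y; rewrite bE fct_sumE; apply: eq_bigr => j _.
  by rewrite fct_sumE; apply: eq_bigr => i _; rewrite mulrA.
have H : is_derive x v (\sum_j \sum_i (fun y => F y i 0 * (B i j *: G y j 0)))
    (\sum_j \sum_i (F x i 0 *: (B i j *: dG j 0) + (B i j *: G x j 0) *: dF i 0)).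
  apply: is_derive_sum => j; apply: is_derive_sum => i.
  by apply: is_deriveM; [exact: is_derive_coord|apply: is_deriveZ; exact: is_derive_coord].
apply: is_derive_eq H _.
rewrite !bE -big_split; apply: eq_bigr => j _; rewrite -big_split.
by apply: eq_bigr => i _ /=; rewrite /GRing.scale/=; ring.
Qed.

Lemma is_derive_mulmx (L : 'M[R]_n) y v :
  is_derive y v (fun z => L *m z) (L *m v).
Proof.
have Ldiff := @linear_differentiable _ _ _ (mulmx L) y (@continuous_mulmx _ _ _ L).
apply: DeriveDef; first exact: diff_derivable.
by rewrite deriveE// diff_lin//; exact: continuous_mulmx.
Qed.

Lemma linear_cV_mulmx (f : {linear 'cV[R]_n -> 'cV[R]_n}) :
  exists L : 'M[R]_n, forall v, f v = L *m v.
Proof.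
exists (\matrix_(i, j) f (delta_mx j 0) i 0) => v.
have vE : v = \sum_j v j 0 *: delta_mx j 0.
  apply/matrixP => i k; rewrite ord1 summxE (bigD1 i)//= !mxE !eqxx mulr1.
  by rewrite big1 ?addr0// => j ji; rewrite !mxE eq_sym (negPf ji) mulr0.
rewrite [in LHS]vE linear_sum; apply/matrixP => i k; rewrite ord1 summxE mxE.
by apply: eq_bigr => j _; rewrite linearZ !mxE mulrC.
Qed.

(* The function [<D_a D_v F, D_w F>] of [a, v, w] is symmetric in
   [a, v] and skew in [v, w], hence zero. *)
Lemma local_isometry_affine (B : 'M[R]_n) (U : set 'cV[R]_n) F x :
  B^T = B -> B \in unitmx -> open U -> U x -> smooth_on U F ->
  (forall u v w, U u -> bform B ('d F u v) ('d F u w) = bform B v w) ->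
  exists g, isometries B g /\ exists2 r : R, 0 < r &
    forall u, ball x r u -> U u /\ F u = aff_act g u.
Proof.
move=> BT Bu Uo Ux Fsm Fiso.
have D0 u v : U u -> 'd F u v = 'D_v F u.
  by move=> Uu; rewrite deriveE//; exact: (Fsm [::]).
have d1 u v : U u -> is_derive u v F ('D_v F u).
  by move=> Uu; apply/derivableP/diff_derivable; exact: (Fsm [::]).
have d2 u v a : U u -> is_derive u a ('D_v F) ('D_a ('D_v F) u).
  by move=> Uu; apply/derivableP/diff_derivable; exact: (Fsm [:: v]).
have c2 u v a i : U u -> {for u, continuous (fun y => 'D_a ('D_v F) y i 0)}.
  move=> Uu; have /differentiable_continuous cD : differentiable ('D_a ('D_v F)) u.
    exact: (Fsm [:: a; v]).
  by apply: (@continuous_comp _ _ _ ('D_a ('D_v F)) (fun M => M i 0)) => //;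
    exact: coord_continuous.
have sym u v a : U u -> 'D_a ('D_v F) u = 'D_v ('D_a F) u.
  move=> Uu; apply/matrixP => i j; rewrite ord1.
  apply: (@schwarz _ _ (fun y => F y i 0) (fun y => 'D_v F y i 0)
    (fun y => 'D_a F y i 0) (fun y => 'D_a ('D_v F) y i 0)
    (fun y => 'D_v ('D_a F) y i 0) u v a U) => //; try exact: c2.
    by move=> y Uy; split; apply: is_derive_coord; exact: d1.
  by move=> y Uy; split; apply: is_derive_coord; exact: d2.
(* The left side is the derivative along [a] of the product of ['D_v F] and ['D_w F], which is
   constant on [U]. *)
have skew u a v w : U u -> bform B ('D_a ('D_v F) u) ('D_w F u) +
    bform B ('D_a ('D_w F) u) ('D_v F u) = 0.
  move=> Uu; rewrite [X in _ + X]bformC//.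
  have := is_derive_bform B (d2 u v a Uu) (d2 u w a Uu) => -[_ <-].
  rewrite (@near_eq_derive _ _ _ _ (cst (bform B v w))) ?derive_cst//.
  near=> y; rewrite -!D0 ?Fiso//; near: y; exact: open_nbhs_nbhs.
have T0 u a v w : U u -> bform B ('D_a ('D_v F) u) ('D_w F u) = 0.
  move=> Uu; have := skew u a v w Uu; have := skew u w a v Uu; have := skew u v w a Uu.
  by rewrite (sym u v a)// (sym u w a)// (sym u w v)//; lra.
have Lex u : U u -> exists L : 'M[R]_n, L \in unitmx /\
    forall v, 'D_v F u = L *m v.
  move=> Uu; have [L LE] := linear_cV_mulmx ('d F u).
  exists L; split; last by move=> v; rewrite -D0.
  by apply: (isometry_unitmx Bu) => v w; rewrite -!LE Fiso.
(* As the differential at [u] is invertible, the vectors ['D_w F u] fill the whole space, and [T0]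
   with non-degeneracy applies. *)
have H0 u a v : U u -> 'D_a ('D_v F) u = 0.
  move=> Uu; have [L [Lu LE]] := Lex u Uu.
  apply: (bform_nondegenerate Bu) => y.
  by rewrite bformC// -(mulKVmx Lu y) -LE T0.
have [r /= r0 xr] : exists2 r : R, 0 < r & ball x r `<=` U.
  by apply/nbhs_ballP; exact: open_nbhs_nbhs.
have [L [Lu LE]] := Lex x Ux.
have DL u v : ball x r u -> 'D_v F u = L *m v.
  move=> xu; rewrite -LE; apply/matrixP => i j; rewrite ord1.
  apply: (@is_derive0_ball_cst _ _ (fun u => 'D_v F u i 0) x r) => // y a xy.
  have := is_derive_coord i (d2 y v a (xr _ xy)).
  by rewrite H0 ?mxE//; exact: xr.
exists (L, F x - L *m x); split.
  by move=> v w /=; rewrite -!LE -!D0// Fiso.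
exists r => // u xu; split; first exact: xr.
rewrite /aff_act/= addrC -[LHS](subrK (L *m u)); congr (_ + _).
apply/matrixP => i j; rewrite ord1.
apply: (@is_derive0_ball_cst _ _ (fun u => (F u - L *m u) i 0) x r) => // y v xy.
have := is_derive_coord i (is_deriveB (d1 y v (xr _ xy)) (is_derive_mulmx L y v)).
by rewrite DL// subrr mxE.
Unshelve. all: by end_near. Qed.

End VectorValuedDerivatives.

(** * Lifting isometries of the quotient *)

Section AffineGroup.
Variables (R : realType) (n : nat).
Implicit Types (g h : affine R n) (x : 'cV[R]_n).

Lemma aff_act_mul g h x : aff_act (aff_mul g h) x = aff_act g (aff_act h x).
Proof. by rewrite /aff_act/= mulmxDr mulmxA addrA. Qed.

Lemma aff_act_one x : aff_act (aff_one R n) x = x.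
Proof. by rewrite /aff_act/= mul1mx addr0. Qed.

Lemma aff_act_invK g : g.1 \in unitmx ->
  cancel (aff_act g) (aff_act (aff_inv g)).
Proof. by move=> gu x; rewrite /aff_act/= mulmxDr mulKmx// addrK. Qed.

Lemma aff_act_inj g h : aff_act g =1 aff_act h -> g = h.
Proof.
by move=> gh; apply: (@affine_eq_open _ _ g h setT openT) => //; exists 0.
Qed.

End AffineGroup.

Section DeckGroup.
Variables (R : realType) (n : nat) (B : 'M[R]_n) (Gamma : set (affine R n)).
Hypotheses (BT : B^T = B) (Bu : B \in unitmx) (GammaB : deck_group B Gamma).
Implicit Types (g h : affine R n) (x y u : 'cV[R]_n).
Local Notation proj := (quotient_proj Gamma).

Let Gamma1 : Gamma (aff_one R n).
Proof. by have [_ [G1 _ _] _ _] := GammaB. Qed.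

Let GammaM g h : Gamma g -> Gamma h -> Gamma (aff_mul g h).
Proof. by have [_ [_ GM _] _ _] := GammaB; exact: GM. Qed.

Let GammaV g : Gamma g -> Gamma (aff_inv g).
Proof. by have [_ [_ _ GV] _ _] := GammaB; exact: GV. Qed.

Lemma deck_unitmx g : Gamma g -> g.1 \in unitmx.
Proof. by have [+ _ _ _] := GammaB => /[apply]; exact: isometry_unitmx. Qed.

Lemma deck_countable : countable Gamma.
Proof. by have [_ _ _ /properly_discontinuous_countable] := GammaB. Qed.

Lemma quotient_proj_eq x y : proj x = proj y ->
  exists2 g, Gamma g & x = aff_act g y.
Proof.
move=> /(congr1 (@proj1_sig _ _))/= xy.
have : orbit_of Gamma x x by exists (aff_one R n); rewrite ?aff_act_one.
by rewrite xy.
Qed.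

Lemma quotient_proj_act g x : Gamma g -> proj (aff_act g x) = proj x.
Proof.
move=> Gg; have E : orbit_of Gamma (aff_act g x) = orbit_of Gamma x.
  apply/seteqP; split=> [_ [h Gh ->]|_ [h Gh ->]].
    by exists (aff_mul h g); [exact: GammaM|rewrite aff_act_mul].
  exists (aff_mul h (aff_inv g)); first exact/GammaM/GammaV.
  by rewrite aff_act_mul aff_act_invK// deck_unitmx.
by rewrite /quotient_proj; apply: eq_exist.
Qed.

Lemma deck_act_inj g h x : Gamma g -> Gamma h ->
  aff_act g x = aff_act h x -> g = h.
Proof.
move=> Gg Gh gh; have [_ _ Gfree _] := GammaB.
have gh1 : aff_mul (aff_inv g) h = aff_one R n.
  apply: (Gfree _ x); first exact/GammaM/Gh/GammaV.
  by rewrite aff_act_mul -gh aff_act_invK// deck_unitmx.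
apply: aff_act_inj => y.
have gu := deck_unitmx Gg.
have := congr1 (fun k => aff_act g (aff_act k y)) gh1.
rewrite aff_act_mul aff_act_one => <-.
by rewrite {1}/aff_act {1}/aff_act/= mulmxDr mulmxN !mulKVmx// subrK.
Qed.

(** At each point of [W] some deck transformation relates the two values; [countable_affine_cover],
    applied to the countable coset of [h], makes it the same one everywhere. *)
Lemma lifts_differ_by_deck g h (W : set 'cV[R]_n) : open W -> W !=set0 ->
  (forall u, W u -> proj (aff_act g u) = proj (aff_act h u)) ->
  exists2 k, Gamma k & g = aff_mul k h.
Proof.
move=> Wo W0 gh.
have : [set aff_mul k h | k in Gamma] g.
  apply: (countable_affine_cover _ Wo W0).
    exact/sub_countable/deck_countable/card_image_le.
  move=> u /gh /quotient_proj_eq[k Gk ->].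
  by exists (aff_mul k h); [exists k|rewrite aff_act_mul].
by move=> [k Gk <-]; exists k.
Qed.

(** Near every point [f] has an affine lift. The lift [phi] found at 0 is continued: at a limit
    point of the set where it lifts [f], it differs from the local lift there by a deck
    transformation, so it lifts [f] around that point too. *)
Lemma quotient_isometry_affine_lift f : smooth_map f -> preserves_metric B f ->
  exists2 phi, isometries B phi & forall u, proj (aff_act phi u) = f (proj u).
Proof.
move=> fsm fB.
have loc x : exists2 psi, isometries B psi & exists2 W, open_nbhs x W &
    forall u, W u -> proj (aff_act psi u) = f (proj u).
  have [U [F [Uo Ux FU Fsm]]] := fsm x.
  have [psi [psiB [r r0 Fpsi]]] :=
    local_isometry_affine BT Bu Uo Ux Fsm (fB U F Uo FU Fsm).
  exists psi => //; exists (ball x r).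
    by split; [exact: ball_open|exact: ballxx].
  by move=> u /Fpsi[Uu <-]; exact: FU.
have [phi phiB [W [Wo W0] phiW]] := loc 0.
exists phi => //.
(* The interior makes the overlap with [W'] open, as [lifts_differ_by_deck] requires. *)
pose S := interior [set u | proj (aff_act phi u) = f (proj u)].
suff ST : S = setT.
  by move=> u; have : S u by [rewrite ST]; move=> /nbhs_singleton.
apply: clopen_cV; last first.
  by exists 0; apply: filterS phiW _; exact: open_nbhs_nbhs.
split; first exact: open_interior.
move=> u Su; have [psi psiB [W' W'u psiW]] := loc u.
have [k Gk phiE] : exists2 k, Gamma k & phi = aff_mul k psi.
  apply: (@lifts_differ_by_deck _ _ (S `&` W')).
  - by apply: openI; [exact: open_interior|case: W'u].
  - exact/Su/open_nbhs_nbhs.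
  - by move=> y [/nbhs_singleton/= -> /psiW ->].
apply: filterS (open_nbhs_nbhs W'u) => y W'y.
by rewrite /= -psiW// phiE aff_act_mul quotient_proj_act.
Qed.

(** * Displacement products on a homogeneous quotient *)

Definition displacement_form g h x : R :=
  bform B (aff_act g x - x) (aff_act h x - x).

(** Since [aff_mul phi g] and [phi] lift the same map of the quotient, they differ by a deck
    transformation [g']; subtracting [phi] leaves its linear part applied to the displacement of
    [g]. *)
Lemma displacement_transport phi g : isometries B phi ->
  (forall u v, proj u = proj v -> proj (aff_act phi u) = proj (aff_act phi v)) ->
  Gamma g -> exists2 g', Gamma g' & forall x,
    aff_act g' (aff_act phi x) - aff_act phi x = phi.1 *m (aff_act g x - x).
Proof.
move=> phiB phiG Gg.
have [|||g' Gg' phig] := @lifts_differ_by_deck (aff_mul phi g) phi setT.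
- exact: openT.
- by exists 0.
- by move=> u _; rewrite aff_act_mul; apply: phiG; exact: quotient_proj_act.
exists g' => // x; rewrite -aff_act_mul -phig aff_act_mul.
by rewrite [in LHS]/aff_act opprD addrACA subrr addr0 mulmxBr.
Qed.

Lemma displacement_form_cst g h x y :
  homogeneous B Gamma -> Gamma g -> Gamma h ->
  displacement_form g h x = displacement_form g h y.
Proof.
move=> hom Gg Gh.
(* Countable, as it involves only triples of deck transformations and the base point 0. *)
pose C := [set displacement_form t.1.1 t.1.2 (aff_act t.2 0) |
  t in (Gamma `*` Gamma) `*` Gamma].
(* An isometry of the quotient taking the class of [z] to that of 0 lifts to [phi], which sends [z]
   into the orbit of 0. *)
have CE z : C (displacement_form g h z).
  have [f [f' [_ _ fsm _ fB]] fz] := hom (proj z) (proj 0).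
  have [phi phiB phif] := quotient_isometry_affine_lift fsm fB.
  have phiG u v : proj u = proj v -> proj (aff_act phi u) = proj (aff_act phi v).
    by rewrite !phif => ->.
  have [g' Gg' gE] := displacement_transport phiB phiG Gg.
  have [h' Gh' hE] := displacement_transport phiB phiG Gh.
  have [k Gk kE] : exists2 k, Gamma k & aff_act phi z = aff_act k 0.
    by apply: quotient_proj_eq; rewrite phif.
  exists (g', h', k) => //=; rewrite -kE /displacement_form gE hE.
  exact: phiB.
have der z v : derivable (displacement_form g h) z v.
  have dk k : is_derive z v (fun u => aff_act k u - u) (k.1 *m v + 0 - v).
    apply: is_deriveB; apply: is_deriveD; exact: is_derive_mulmx.
  by have [] := is_derive_bform B (dk g) (dk h).
(* Restriction to the line with [y] at parameter 0 and [x] at parameter 1. *)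
have := @countable_range_cst _ (fun t => displacement_form g h (t *: (x - y) + y)) C.
move=> /(_ _ _ _ 1 0); rewrite scale1r subrK scale0r add0r; apply.
- move=> t; apply: differentiable_continuous; apply/derivable1_diffP.
  by have [] := is_derive_line (derivableP (der (t *: (x - y) + y) (x - y))).
- apply: sub_countable (card_image_le _ _) _; apply: countableX.
    by apply: countableX; exact: deck_countable.
  exact: deck_countable.
- by move=> t; exact: CE.
Qed.

End DeckGroup.

Theorem corollary3p11 (R : realType) (n s : nat) (B : 'M[R]_n)
    (Gamma : set (affine R n)) :
  (s <= n - s)%N ->
  has_signature B (n - s) s ->
  deck_group B Gamma ->
  homogeneous B Gamma ->
  ~ abelian_mxset (holonomy Gamma) ->
  (14 <= n)%N /\ (7 <= s <= n - s)%N.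
Proof.
move=> sn Bsig Gdeck Ghom nab.
have [BT Bu] := has_signature_nondegenerate Bsig.
have [[L1 v1] [[L2 v2] [G1 G2 L12]]] : exists g1 g2 : affine R n,
    [/\ Gamma g1, Gamma g2 & g1.1 *m g2.1 <> g2.1 *m g1.1].
  apply: contrapT => nex; apply: nab => L1 L2 [v1 G1] [v2 G2].
  by apply: contrapT => L12; apply: nex; exists (L1, v1), (L2, v2).
have iso L v : Gamma (L, v) -> forall x y,
    bform B ((1%:M + (L - 1%:M)) *m x) ((1%:M + (L - 1%:M)) *m y) = bform B x y.
  have [GB _ _ _] := Gdeck.
  by move=> /GB LB x y; rewrite addrC subrK; exact: LB.
have cst L v L' v' : Gamma (L, v) -> Gamma (L', v') -> forall x,
    bform B ((L - 1%:M) *m x + v) ((L' - 1%:M) *m x + v') = bform B v v'.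
  move=> G G' x; have := displacement_form_cst BT Bu Gdeck x 0 Ghom G G'.
  rewrite /displacement_form /aff_act/= !mulmx0 !add0r !subr0 => <-.
  by rewrite !mulmxBl !mul1mx (addrAC _ _ v) (addrAC _ _ v').
suff s7 : (7 <= s)%N by split; lia.
apply: (@noncommuting_index_ge7 _ _ _ _ B (L1 - 1%:M) (L2 - 1%:M) v1 v2 Bsig).
- exact: iso G1.
- exact: iso G2.
- exact: cst.
- exact: cst.
- exact: cst.
- rewrite !mulmxBl !mulmxBr !mul1mx !mulmx1 => E; apply: L12 => /=.
  move: (L1 *m L2) (L2 *m L1) E => a b E; apply/matrixP => i j.
  by have := congr1 (fun M : 'M[R]_n => M i j) E; rewrite !mxE; lra.
(* By [E] the two products of the chosen elements agree at [x]. The action is free, so the products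
   coincide, and so do their linear parts. *)
- move=> x E; apply: L12.
  suff /(congr1 fst) : aff_mul (L1, v1) (L2, v2) = aff_mul (L2, v2) (L1, v1) by [].
  have [_ [_ GM _] _ _] := Gdeck.
  apply: (deck_act_inj Bu Gdeck (x := x) (GM _ _ G1 G2) (GM _ _ G2 G1)).
  move: E; rewrite /aff_act/= !mulmxBl !mulmxBr !mul1mx !mulmx1 !mulmxBl.
  rewrite !mul1mx.
  move: (L1 *m L2 *m x) (L2 *m L1 *m x) (L1 *m x) (L2 *m x) => a b c d.
  move: (L1 *m v2) (L2 *m v1) => e f E; apply/matrixP => i j.
  by have := congr1 (fun M : 'cV_n => M i j) E; rewrite !mxE; lra.
Qed.
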